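(* Let $\mathcal{G}$ be a discrete groupoid with finite unit space $\mathcal{G}^{(0)}$, and let $\pi\colon \mathbb{C}F(\mathcal{G}) \to A(\mathcal{G})$, $\pi(\delta_U)=1_U$, be the representation of the topological full group of $\mathcal{G}$ in its complex Steinberg algebra. Then $$\overline{\pi(\mathbb{C}F(\mathcal{G}))}^{\|\cdot\|_{\mathrm{max}}} = C^*(\mathcal{G})$$ if and only if $\mathcal{G}$ is a group.
   Context: A groupoid $\mathcal{G}$ is a small category in which every morphism is invertible, identified with its set of morphisms; all groupoids are assumed nonempty. Range and source are $r(\gamma)=\gamma\gamma^{-1}$, $s(\gamma)=\gamma^{-1}\gamma$; $\alpha\beta$ is defined if and only if $s(\alpha)=r(\beta)$; the unit space is $\mathcal{G}^{(0)}=r(\mathcal{G})=s(\mathcal{G})$. A groupoid is a group if and only if $\mathcal{G}^{(0)}$ is a singleton. A discrete groupoid is a groupoid with the discrete topology. A bisection is a subset $B\subseteq\mathcal{G}$ on which $r$ and $s$ are both injective; in a discrete groupoid, the compact open bisections are the finite bisections. For a discrete groupoid $\mathcal{G}$, the complex Steinberg algebra $A(\mathcal{G})$ equals $C_c(\mathcal{G})$, the finitely supported functions $\mathcal{G}\to\mathbb{C}$, with convolution $(f*g)(\gamma)=\sum_{\alpha\beta=\gamma}f(\alpha)g(\beta)$ and involution $f^*(\gamma)=\overline{f(\gamma^{-1})}$. The full groupoid C*-algebra $C^*(\mathcal{G})$ is the completion of $C_c(\mathcal{G})$ in the full C*-norm $\|f\|_{\mathrm{max}}=\sup\{\|\rho(f)\|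 : \rho\colon C_c(\mathcal{G})\to B(\mathcal{H}) \text{ is a } *\text{-representation for some Hilbert space } \mathcal{H}\}$. The closure in the claim is taken in $C^*(\mathcal{G})$. If $\mathcal{G}^{(0)}$ is finite, the topological full group $F(\mathcal{G})$ is the (discrete) group of all compact open bisections $B$ of $\mathcal{G}$ that are full, i.e. $r(B)=s(B)=\mathcal{G}^{(0)}$, with product $AB=\{\alpha\beta : \alpha\in A,\ \beta\in B,\ s(\alpha)=r(\beta)\}$ and inverse $B^{-1}=\{\gamma^{-1} : \gamma\in B\}$. The complex group ring $\mathbb{C}F(\mathcal{G})$ has basis $\{\delta_U : U\in F(\mathcal{G})\}$, and $\pi$ is the $*$-homomorphism that is the linear extension of $\delta_U\mapsto 1_U$, where $1_U$ is the characteristic function of $U$. *)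

(* Defs.v *)
From HB Require Import structures.
From mathcomp Require Import all_boot all_order all_algebra.
From mathcomp Require Import all_classical all_reals all_analysis.
From mathcomp Require Import complex ring_quotient lra.

Set Implicit Arguments.
Unset Strict Implicit.
Unset Printing Implicit Defensive.

Import Order.TTheory GRing.Theory Num.Theory.
Import numFieldNormedType.Exports.

Local Open Scope classical_set_scope.
Local Open Scope ring_scope.
Local Open Scope complex_scope.

Lemma ReK_ge0 (R : realType) (z : R[i]) : 0 <= z -> (complex.Re z)%:C = z.
Proof. by case: z => a b; rewrite lecE /= => /andP[/eqP ->]. Qed.

Lemma Re_nneg (R : realType) (z : R[i]) : 0 <= z -> 0 <= complex.Re z.
Proof. by case: z => a b; rewrite lecE /= => /andP[]. Qed.

Section Completion.
Variables (R : realType) (V : lmodType R[i]).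

(* Completion of V in the seminorm p: Cauchy sequences modulo the sequences   *)
(* along which p tends to 0, normed by the limit of p.                        *)
Record seminorm := Seminorm {
  seminorm_fun :> V -> R;
  seminormD : forall x y,
    seminorm_fun (x + y) <= seminorm_fun x + seminorm_fun y;
  seminormZ : forall (a : R[i]) x,
    seminorm_fun (a *: x) = complex.Re `|a| * seminorm_fun x
}.

Variable p : seminorm.

Lemma seminorm0 : p 0 = 0.
Proof. by rewrite -(scale0r 0) seminormZ normr0 mul0r. Qed.

Lemma seminormN x : p (- x) = p x.
Proof. by rewrite -scaleN1r seminormZ normrN normr1 mul1r. Qed.

Lemma seminorm_ge0 x : 0 <= p x.
Proof.
have := seminormD p x (- x); rewrite subrr seminorm0 seminormN -mulr2n.
by rewrite pmulrn_lge0.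
Qed.

Lemma seminorm_dist x y : `|p x - p y| <= p (x - y).
Proof.
have h a b : p a <= p (a - b) + p b.
  by rewrite -{1}(subrK b a) seminormD.
have := h x y; have := h y x; rewrite -(seminormN (y - x)) opprB => hy hx.
by rewrite ler_norml; apply/andP; split; lra.
Qed.

Definition cauchy_seqs : {pred nat -> V} :=
  [pred u | `[< forall e, 0 < e -> exists N, forall m n,
    (N <= m)%N -> (N <= n)%N -> p (u m - u n) < e >]].

Lemma cauchy_seqsP (u : nat -> V) :
  reflect (forall e, 0 < e -> exists N, forall m n,
    (N <= m)%N -> (N <= n)%N -> p (u m - u n) < e) (u \in cauchy_seqs).
Proof. exact: asboolP. Qed.

Fact cauchy_seqs_submod : submod_closed cauchy_seqs.
Proof.
split=> [|a u v /cauchy_seqsP cu /cauchy_seqsP cv]; apply/cauchy_seqsP => e e0.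
  by exists 0%N => m n _ _; rewrite subrr seminorm0.
have a0 : 0 < complex.Re `|a| + 1.
  rewrite ltr_wpDl//; have := normr_ge0 a; rewrite lecE /= => /andP[_ //].
have [N HN] := cu (e / 2 / (complex.Re `|a| + 1)) (divr_gt0 (divr_gt0 e0 (ltr0Sn _ 1)) a0).
have [M HM] := cv (e / 2) (divr_gt0 e0 (ltr0Sn _ 1)).
exists (maxn N M) => m n; rewrite !geq_max => /andP[Nm Mm] /andP[Nn Mn].
rewrite !fctE opprD addrACA -scalerBr (le_lt_trans (seminormD _ _ _))//.
rewrite (splitr e) ltr_leD// ?(ltW (HM _ _ _ _))// seminormZ.
have := HN m n Nm Nn; rewrite ltr_pdivlMr// mulrC => /le_lt_trans; apply.
by rewrite ler_wpM2r ?seminorm_ge0// lerDl.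
Qed.
HB.instance Definition _ :=
  GRing.isSubmodClosed.Build R[i] (nat -> V) cauchy_seqs cauchy_seqs_submod.

Record cauchy_seq :=
  CauchySeq { cauchy_seq_fun :> nat -> V; _ : cauchy_seq_fun \in cauchy_seqs }.

HB.instance Definition _ := [isSub for cauchy_seq_fun].
HB.instance Definition _ := [Choice of cauchy_seq by <:].
HB.instance Definition _ := [SubChoice_isSubLmodule of cauchy_seq by <:].

Definition lim_seminorm (u : cauchy_seq) : R := lim (p (u n) @[n --> \oo]).

Lemma cvg_lim_seminorm (u : cauchy_seq) :
  p (u n) @[n --> \oo] --> lim_seminorm u.
Proof.
apply/cauchy_cvgP/cauchy_exP => e e0.
have /cauchy_seqsP /(_ e e0) [N HN] := valP u.
exists (p (u N)); exists N => // n /= Nn.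
by apply: le_lt_trans (seminorm_dist _ _) _; exact: HN.
Qed.

Lemma lim_seminormD u v :
  lim_seminorm (u + v) <= lim_seminorm u + lim_seminorm v.
Proof.
have h : p (u n) + p (v n) @[n --> \oo] --> lim_seminorm u + lim_seminorm v.
  exact: cvgD (@cvg_lim_seminorm u) (@cvg_lim_seminorm v).
apply: (ler_cvg_to (@cvg_lim_seminorm (u + v)) h).
by near=> n; exact: seminormD.
Unshelve. all: by end_near. Qed.

Lemma lim_seminormZ a u : lim_seminorm (a *: u) = complex.Re `|a| * lim_seminorm u.
Proof.
apply/cvg_lim => //; under eq_cvg do rewrite seminormZ.
by apply: cvgMl_tmp; exact: cvg_lim_seminorm.
Qed.

Definition null_seqs : {pred cauchy_seq} := [pred u | lim_seminorm u == 0].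

Lemma lim_seminorm_ge0 u : 0 <= lim_seminorm u.
Proof.
apply: (limr_ge (cvgP _ (@cvg_lim_seminorm u))).
by near=> n; exact: seminorm_ge0.
Unshelve. all: by end_near. Qed.

Lemma lim_seminormN u : lim_seminorm (- u) = lim_seminorm u.
Proof. by rewrite -scaleN1r lim_seminormZ normrN normr1 mul1r. Qed.

Fact null_seqs_zmod : zmod_closed null_seqs.
Proof.
split=> [|u v]; rewrite !inE.
  by rewrite -(scale0r 0) lim_seminormZ normr0 mul0r.
move=> /eqP u0 /eqP v0; rewrite eq_le lim_seminorm_ge0 andbT.
by rewrite (le_trans (lim_seminormD _ _))// u0 lim_seminormN v0 addr0.
Qed.
HB.instance Definition _ :=
  GRing.isZmodClosed.Build cauchy_seq null_seqs null_seqs_zmod.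

Definition completion := Quotient.quot null_seqs.
HB.instance Definition _ := GRing.Zmodule.on completion.

HB.instance Definition _ := EqQuotient.on completion.

Local Notation cls u := (\pi_completion (u : cauchy_seq))%qT.

Lemma cls_eq u v : (cls u = cls v) <-> lim_seminorm (u - v) = 0.
Proof.
split=> [/eqP|uv].
  by rewrite -Quotient.idealrBE => /eqP.
by apply/eqP; rewrite -Quotient.idealrBE; apply/eqP.
Qed.

Lemma cls_repr (x : completion) : cls (repr x) = x.
Proof. exact: reprK. Qed.

Lemma clsD u v : cls (u + v) = cls u + cls v.
Proof. by rewrite !piE. Qed.

Lemma cls0 : cls 0 = 0.
Proof. by rewrite !piE. Qed.

Lemma clsN u : cls (- u) = - cls u.
Proof. by rewrite !piE. Qed.

Definition completion_scale a (x : completion) : completion :=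
  cls (a *: repr x).

Lemma clsZ a u : cls (a *: u) = completion_scale a (cls u).
Proof.
apply/cls_eq; rewrite -scalerBr lim_seminormZ.
by rewrite (_ : lim_seminorm _ = 0) ?mulr0//; apply/cls_eq; rewrite cls_repr.
Qed.

Fact completion_scaleA a b x :
  completion_scale a (completion_scale b x) = completion_scale (a * b) x.
Proof. by rewrite -(cls_repr x) -!clsZ scalerA. Qed.
Fact completion_scale1 : left_id 1 completion_scale.
Proof. by move=> x; rewrite -(cls_repr x) -!clsZ scale1r. Qed.
Fact completion_scaleDr : right_distributive completion_scale +%R.
Proof.
move=> a x y; rewrite -(cls_repr x) -(cls_repr y) -!clsZ -!clsD -clsZ.
by rewrite scalerDr clsD.
Qed.
Fact completion_scaleDl x : {morph completion_scale^~ x : a b / a + b}.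
Proof. by move=> a b; rewrite -(cls_repr x) -!clsZ -!clsD scalerDl. Qed.

HB.instance Definition _ := GRing.Zmodule_isLmodule.Build R[i] completion
  completion_scaleA completion_scale1 completion_scaleDr completion_scaleDl.

Definition completion_norm (x : completion) : R[i] :=
  (lim_seminorm (repr x))%:C.

Lemma completion_norm_cls u : completion_norm (cls u) = (lim_seminorm u)%:C.
Proof.
congr (_%:C); have uv : lim_seminorm (repr (cls u) - u) = 0.
  by apply/cls_eq; rewrite cls_repr.
apply/eqP; rewrite eq_le; apply/andP; split.
  rewrite -[leLHS]/(lim_seminorm (repr (cls u))) -{1}(subrK u (repr (cls u))).
  by rewrite (le_trans (lim_seminormD _ _))// uv add0r.
rewrite -{1}(subrK (repr (cls u)) u) (le_trans (lim_seminormD _ _))//.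
by rewrite -lim_seminormN opprB uv add0r.
Qed.

Fact completion_normD x y :
  completion_norm (x + y) <= completion_norm x + completion_norm y.
Proof.
rewrite -(cls_repr x) -(cls_repr y) -clsD !completion_norm_cls -rmorphD lecR.
exact: lim_seminormD.
Qed.
Fact completion_normZ a x :
  completion_norm (a *: x) = `|a| * completion_norm x.
Proof.
rewrite -(cls_repr x) -[a *: _]/(completion_scale a _) -clsZ.
by rewrite !completion_norm_cls lim_seminormZ rmorphM /= (ReK_ge0 (normr_ge0 a)).
Qed.
Fact completion_norm_eq0 x : completion_norm x = 0 -> x = 0.
Proof.
rewrite -(cls_repr x) completion_norm_cls => -[x0].
by rewrite -cls0; apply/cls_eq; rewrite subr0.
Qed.
HB.instance Definition _ := Lmodule_isNormed.Build R[i] completion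
  completion_normD completion_normZ completion_norm_eq0.

Fact const_cauchy (x : V) : (fun _ : nat => x) \in cauchy_seqs.
Proof.
by apply/cauchy_seqsP => e e0; exists 0%N => m n _ _; rewrite subrr seminorm0.
Qed.

Definition to_completion (x : V) : completion := cls (CauchySeq (const_cauchy x)).

Lemma to_completion_linear : linear to_completion.
Proof.
move=> a x y.
transitivity (cls (a *: CauchySeq (const_cauchy x) + CauchySeq (const_cauchy y))).
  by congr (cls _); apply/val_inj.
by rewrite clsD clsZ.
Qed.
HB.instance Definition _ := GRing.isLinear.Build R[i] V completion _
  to_completion to_completion_linear.

Lemma norm_to_completion x : `|to_completion x| = (p x)%:C.
Proof.
rewrite -[LHS]/(completion_norm _) completion_norm_cls; congr (_%:C).
apply/cvg_lim => //; exact: (cvg_cst (p x)).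
Qed.

Lemma norm_cls u : `|cls u| = (lim_seminorm u)%:C.
Proof. exact: completion_norm_cls. Qed.

Lemma gt0_complex (e : R[i]) : 0 < e -> exists2 r : R, 0 < r & e = r%:C.
Proof.
by case: e => a b; rewrite ltcE /= => /andP[/eqP -> a0]; exists a.
Qed.

Lemma cvg_to_completion (u : cauchy_seq) :
  to_completion (u n) @[n --> \oo] --> cls u.
Proof.
apply/cvgrPdistC_lt => _ /gt0_complex[r r0 ->].
have /cauchy_seqsP /(_ (r / 2) (divr_gt0 r0 (ltr0Sn _ 1))) [N HN] := valP u.
exists N => // n /= Nn; rewrite -clsN -clsD norm_cls ltcR.
rewrite (@le_lt_trans _ _ (r / 2)) ?ltr_pdivrMr ?mulr_natr ?mulr2n ?ltrDl//.
apply: (limr_le (cvgP _ (@cvg_lim_seminorm _))); exists N => // m /= Nm.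
exact/ltW/HN.
Qed.

Lemma to_completion_approx (x : completion) (r : R) :
  0 < r -> exists v, `|x - to_completion v| < r%:C.
Proof.
move=> r0; have rC0 : 0 < r%:C :> R[i] by rewrite ltcR.
have := @cvg_to_completion (repr x); rewrite cls_repr => /cvgrPdist_lt /(_ _ rC0).
by case=> N _ /(_ N (leqnn N)); exists (repr x N).
Qed.

Lemma dense_to_completion : dense (range to_completion).
Proof.
move=> O [x Ox] Oo.
have /nbhs_normP[_ /gt0_complex[r r0 ->] rO] : nbhs x O.
  exact: open_nbhs_nbhs.
by have [v xv] := to_completion_approx x r0; exists (to_completion v); split;
  [exact: rO|exists v].
Qed.

Fact completion_complete (F : set_system completion) :
  ProperFilter F -> cauchy F -> cvg F.
Proof.
move=> FF Fc.
have H (n : nat) : exists v, F (ball (to_completion v) (n.+1%:R^-1)%:C).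
  have n0 : 0 < n.+1%:R^-1 / 2 :> R by rewrite divr_gt0 ?invr_gt0.
  have nC0 : 0 < (n.+1%:R^-1 / 2)%:C :> R[i] by rewrite ltcR.
  have /cauchyP /(_ _ nC0) [x Fx] := Fc.
  have [v xv] := to_completion_approx x n0; exists v.
  apply: filterS Fx => y; rewrite -!ball_normE /= => xy.
  rewrite (splitr n.+1%:R^-1) rmorphD -(subrKA x) (le_lt_trans (ler_normD _ _))//.
  by rewrite ltrD// distrC.
have {H} [v Fv] := choice H.
have inv_small (r : R) : 0 < r -> exists N : nat, forall n, (N <= n)%N ->
    n.+1%:R^-1 < r.
  move=> r0; have [N _ HN] := near_infty_natSinv_lt (PosNum r0).
  by exists N => n Nn; exact: HN.
have vc : v \in cauchy_seqs.
  apply/cauchy_seqsP => e e0.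
  have [N HN] := inv_small (e / 2) (divr_gt0 e0 (ltr0Sn _ 1)).
  exists N => m n Nm Nn; rewrite -ltcR -norm_to_completion raddfB.
  have [y [my ny]] := filter_ex (filterI (Fv m) (Fv n)).
  move: my ny; rewrite -!ball_normE /= => my ny.
  rewrite -(subrKA y) (le_lt_trans (ler_normD _ _))// (splitr e) rmorphD ltrD//.
    by rewrite (lt_trans my)// ltcR HN.
  by rewrite distrC (lt_trans ny)// ltcR HN.
apply/cvg_ex; exists (cls (CauchySeq vc)).
apply/fcvgrPdist_lt => _ /gt0_complex[r r0 ->].
have r2 : 0 < r / 2 by rewrite divr_gt0.
have rC2 : 0 < (r / 2)%:C :> R[i] by rewrite ltcR.
have /cvgrPdist_lt /(_ _ rC2) [M _ HM] := @cvg_to_completion (CauchySeq vc).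
have [N HN] := inv_small _ r2.
pose n := maxn M N.
apply: filterS (Fv n) => y; rewrite -ball_normE /= => ny.
rewrite -(subrKA (to_completion (v n))) (le_lt_trans (ler_normD _ _))//.
rewrite (splitr r) rmorphD ltrD//; first exact: (HM n (leq_maxl _ _)).
by rewrite (lt_trans ny)// ltcR HN// leq_maxr.
Qed.
HB.instance Definition _ := Uniform_isComplete.Build completion completion_complete.

End Completion.

(* Finitely supported functions. K^o is K viewed as a module over itself, so  *)
(* that T -> K^o has its pointwise K-module structure.                        *)
Section FinitelySupported.
Variables (K : numFieldType) (T : Type).

Definition finsupp : {pred T -> K^o} :=
  [pred f | `[< finite_set (f @^-1` [set~ 0]) >]].

Lemma finsuppP (f : T -> K^o) :
  reflect (finite_set (f @^-1` [set~ 0])) (f \in finsupp).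
Proof. exact: asboolP. Qed.

Fact finsupp_submod_closed : submod_closed finsupp.
Proof.
split=> [|a f g /finsuppP ff /finsuppP fg]; apply/finsuppP.
  by rewrite (_ : _ @^-1` _ = set0)//; apply/seteqP; split=> x //=; apply.
apply: (@sub_finite_set _ _ (f @^-1` [set~ 0] `|` g @^-1` [set~ 0])); last first.
  by rewrite finite_setU.
move=> x /= afg; have [fx0|/eqP fx0] := eqVneq (f x) 0; last by left.
by right=> gx0; apply: afg; rewrite !fctE fx0 gx0 scaler0 addr0.
Qed.
HB.instance Definition _ :=
  GRing.isSubmodClosed.Build K (T -> K^o) finsupp finsupp_submod_closed.

Record fsupp := FSupp { fsupp_fun :> T -> K^o; _ : fsupp_fun \in finsupp }.

HB.instance Definition _ := [isSub for fsupp_fun].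
HB.instance Definition _ := [Choice of fsupp by <:].
HB.instance Definition _ := [SubChoice_isSubLmodule of fsupp by <:].

Lemma fsupp_finite (f : fsupp) : finite_set (f @^-1` [set~ 0]).
Proof. exact/finsuppP/(valP f). Qed.

Lemma fsuppP (f g : fsupp) : f = g <-> forall x, f x = g x.
Proof. by split=> [->//|fg]; apply/val_inj/funext. Qed.

Fact indic_finsupp (U : set T) : finite_set U -> (\1_U : T -> K^o) \in finsupp.
Proof.
move=> fU; apply/finsuppP; apply: sub_finite_set fU => x /=.
by rewrite indicE; case: (boolP (x \in U)) => [/set_mem//|_]; case.
Qed.

Definition fsupp_indic (U : set T) (fU : finite_set U) : fsupp :=
  FSupp (indic_finsupp fU).

End FinitelySupported.

(* A groupoid as its set of morphisms, with r a = a a^-1 and s a = a^-1 a. The *)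
(* product a b is meaningful only if s a = r b: gpd_mul is a total function   *)
(* whose other values are unconstrained and never used (a, a^-1 and a^-1, a   *)
(* are composable because the inverse is involutive). Nonemptiness is part of *)
(* the structure.                                                             *)
HB.mixin Record isGroupoid T := {
  gpd_mul : T -> T -> T;
  gpd_inv : T -> T;
  gpd_invK : involutive gpd_inv;
  gpd_mul_rng_subproof : forall a, gpd_mul (gpd_mul a (gpd_inv a)) a = a;
  gpd_mul_src_subproof : forall a, gpd_mul a (gpd_mul (gpd_inv a) a) = a;
  gpd_rngM_subproof : forall a b,
    gpd_mul (gpd_inv a) a = gpd_mul b (gpd_inv b) ->
    gpd_mul (gpd_mul a b) (gpd_inv (gpd_mul a b)) = gpd_mul a (gpd_inv a);
  gpd_srcM_subproof : forall a b,
    gpd_mul (gpd_inv a) a = gpd_mul b (gpd_inv b) ->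
    gpd_mul (gpd_inv (gpd_mul a b)) (gpd_mul a b) = gpd_mul (gpd_inv b) b;
  gpd_mulA_subproof : forall a b c,
    gpd_mul (gpd_inv a) a = gpd_mul b (gpd_inv b) ->
    gpd_mul (gpd_inv b) b = gpd_mul c (gpd_inv c) ->
    gpd_mul a (gpd_mul b c) = gpd_mul (gpd_mul a b) c;
  gpd_nonempty : inhabited T
}.

#[short(type="groupoidType")]
HB.structure Definition Groupoid := {T of isGroupoid T & Choice T}.

Section GroupoidTheory.
Variable G : groupoidType.
Implicit Types (a b c : G) (U V : set G).

Definition gpd_rng a : G := gpd_mul a (gpd_inv a).
Definition gpd_src a : G := gpd_mul (gpd_inv a) a.
Definition composable a b := gpd_src a = gpd_rng b.

Definition gpd_units : set G := range gpd_rng.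

Definition is_group : Prop := exists e, gpd_units = [set e].

Lemma gpd_mul_rng a : gpd_mul (gpd_rng a) a = a.
Proof. exact: gpd_mul_rng_subproof. Qed.

Lemma gpd_mul_src a : gpd_mul a (gpd_src a) = a.
Proof. exact: gpd_mul_src_subproof. Qed.

Lemma gpd_rngM a b : composable a b -> gpd_rng (gpd_mul a b) = gpd_rng a.
Proof. exact: gpd_rngM_subproof. Qed.

Lemma gpd_srcM a b : composable a b -> gpd_src (gpd_mul a b) = gpd_src b.
Proof. exact: gpd_srcM_subproof. Qed.

Lemma gpd_mulA a b c : composable a b -> composable b c ->
  gpd_mul a (gpd_mul b c) = gpd_mul (gpd_mul a b) c.
Proof. exact: gpd_mulA_subproof. Qed.

Lemma gpd_rngV a : gpd_rng (gpd_inv a) = gpd_src a.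
Proof. by rewrite /gpd_rng gpd_invK. Qed.

Lemma gpd_srcV a : gpd_src (gpd_inv a) = gpd_rng a.
Proof. by rewrite /gpd_src gpd_invK. Qed.

Lemma gpd_rng_rng a : gpd_rng (gpd_rng a) = gpd_rng a.
Proof. by rewrite {2}/gpd_rng gpd_rngM// /composable gpd_rngV. Qed.

Lemma gpd_src_rng a : gpd_src (gpd_rng a) = gpd_rng a.
Proof. by rewrite {1}/gpd_rng gpd_srcM ?gpd_srcV// /composable gpd_rngV. Qed.

Lemma gpd_inv_rng a : gpd_inv (gpd_rng a) = gpd_rng a.
Proof.
rewrite -[LHS]gpd_mul_rng gpd_rngV gpd_src_rng.
by rewrite -[LHS]/(gpd_rng (gpd_rng a)) gpd_rng_rng.
Qed.

Lemma gpd_units_src : range gpd_src = gpd_units.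
Proof.
apply/seteqP; split=> _ [a _ <-]; exists (gpd_inv a) => //.
  exact: gpd_rngV.
exact: gpd_srcV.
Qed.

Definition bisection U := set_inj U gpd_rng /\ set_inj U gpd_src.

(* The groupoid is discrete, so that the compact open subsets are the finite  *)
(* ones.                                                                      *)
Definition full_bisection U := [/\ finite_set U, bisection U,
  gpd_rng @` U = gpd_units & gpd_src @` U = gpd_units].

Definition bisection_mul U V : set G :=
  [set c | exists a b, [/\ U a, V b, composable a b & c = gpd_mul a b]].
Definition bisection_inv U : set G := gpd_inv @` U.

Definition full_group := set_type [set U | full_bisection U].
HB.instance Definition _ := Choice.on full_group.

Lemma bisection_mul_finite U V :
  finite_set U -> finite_set V -> finite_set (bisection_mul U V).
Proof.
move=> fU fV; apply: sub_finite_set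
  (finite_image (fun p => gpd_mul p.1 p.2) (finite_setX fU fV)).
by move=> _ [a [b [Ua Vb _ ->]]]; exists (a, b).
Qed.

Lemma bisection_inv_finite U : finite_set U -> finite_set (bisection_inv U).
Proof. exact: finite_image. Qed.

Lemma full_bisection_mul U V :
  full_bisection U -> full_bisection V -> full_bisection (bisection_mul U V).
Proof.
move=> [fU [rU sU] rUE sUE] [fV [rV sV] rVE sVE]; split.
- exact: bisection_mul_finite.
- split=> x y; rewrite !inE => -[a [b [Ua Vb ab ->]]] [a' [b' [Ua' Vb' ab' ->]]].
    rewrite !gpd_rngM// => /rU; rewrite !inE => /(_ Ua Ua') aa'.
    have bb' : b = b' by apply: rV; rewrite ?inE//; rewrite -ab -ab' aa'.
    by rewrite aa' bb'.
  rewrite !gpd_srcM// => /sV; rewrite !inE => /(_ Vb Vb') bb'.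
  have aa' : a = a' by apply: sU; rewrite ?inE//; rewrite ab ab' bb'.
  by rewrite aa' bb'.
- apply/seteqP; split=> [_ [_ [a [b [_ _ ab ->]]] <-]|e].
    by rewrite gpd_rngM//; exists a.
  rewrite -rUE => -[a Ua <-].
  have : gpd_units (gpd_src a) by rewrite -sUE; exists a.
  rewrite -rVE => -[b Vb ba].
  by exists (gpd_mul a b); [exists a, b|rewrite gpd_rngM].
- apply/seteqP; split=> [_ [_ [a [b [_ _ ab ->]]] <-]|e].
    by rewrite gpd_srcM// -gpd_units_src; exists b.
  rewrite -sVE => -[b Vb <-].
  have : gpd_units (gpd_rng b) by exists b.
  rewrite -sUE => -[a Ua ab].
  by exists (gpd_mul a b); [exists a, b|rewrite gpd_srcM].
Qed.

Lemma full_bisection_inv U : full_bisection U -> full_bisection (bisection_inv U).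
Proof.
move=> [fU [rU sU] rUE sUE]; split; first exact: bisection_inv_finite.
- split=> x y; rewrite !inE => -[a Ua <-] [b Ub <-].
    by rewrite !gpd_rngV => /sU ->//; rewrite inE.
  by rewrite !gpd_srcV => /rU ->//; rewrite inE.
- rewrite -sUE /bisection_inv image_comp; apply: eq_imagel => a _.
  exact: gpd_rngV.
- rewrite -rUE /bisection_inv image_comp; apply: eq_imagel => a _.
  exact: gpd_srcV.
Qed.

Lemma full_bisection_units : finite_set gpd_units -> full_bisection gpd_units.
Proof.
move=> fin; split=> //.
- by split=> _ _ /set_mem[a _ <-] /set_mem[b _ <-];
    rewrite ?gpd_rng_rng ?gpd_src_rng.
- apply/seteqP; split=> [e [a _ <-]|e [a _ <-]]; first by exists a.
  by exists (gpd_rng a); [exists a|exact: gpd_rng_rng].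
- rewrite -[RHS]image_id; apply: eq_imagel => _ [a _ <-].
  exact: gpd_src_rng.
Qed.

Definition full_group_mul (U V : full_group) : full_group :=
  SigSub (mem_set (full_bisection_mul (set_mem (valP U)) (set_mem (valP V)))).

Definition full_group_inv (U : full_group) : full_group :=
  SigSub (mem_set (full_bisection_inv (set_mem (valP U)))).

End GroupoidTheory.

Section SteinbergAlgebra.
Variables (R : realType) (G : groupoidType).
Local Notation C := R[i].

(* The Steinberg algebra of a discrete groupoid, with convolution and star.   *)
Definition Cc := fsupp C G.
HB.instance Definition _ := GRing.Lmodule.on Cc.

Definition convolution_fun (f g : Cc) (c : G) : C :=
  \sum_(p \in [set p : G * G | composable p.1 p.2 /\ gpd_mul p.1 p.2 = c])
    f p.1 * g p.2.

Fact convolution_finsupp f g : (convolution_fun f g : G -> C^o) \in @finsupp C G.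
Proof.
apply/finsuppP; apply: sub_finite_set (finite_image (fun p => gpd_mul p.1 p.2)
  (finite_setX (fsupp_finite f) (fsupp_finite g))).
move=> c /=; apply: contra_notP => H.
apply: fsbig1 => -[a b] /= [ab abc].
have [->|/eqP fa] := eqVneq (f a) 0; first by rewrite mul0r.
have [->|/eqP gb] := eqVneq (g b) 0; first by rewrite mulr0.
by exfalso; apply: H; exists (a, b).
Qed.

Definition convolution (f g : Cc) : Cc := FSupp (convolution_finsupp f g).

Fact star_finsupp (f : Cc) :
  (fun c => Num.conj (f (gpd_inv c)) : C^o) \in @finsupp C G.
Proof.
apply/finsuppP; apply: sub_finite_set
  (finite_image (@gpd_inv G) (fsupp_finite f)) => c /= fc.
exists (gpd_inv c); last exact: gpd_invK.
by move=> f0; apply: fc; rewrite f0 conjC0.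
Qed.

Definition star (f : Cc) : Cc := FSupp (star_finsupp f).

Lemma convolution_indic (U V : set G) (fU : finite_set U) (fV : finite_set V) :
  bisection U -> bisection V ->
  convolution (fsupp_indic C fU) (fsupp_indic C fV) =
  fsupp_indic C (bisection_mul_finite fU fV).
Proof.
move=> [rU _] [rV _]; apply/fsuppP => c.
rewrite [LHS]/= /convolution_fun [RHS]/= indicE.
have [/set_mem [a [b [Ua Vb ab ->]]]|nc] := boolP (c \in _).
  rewrite -(@fsbig_widen _ _ 0 _ [set (a, b)]) => [|p ->//|[a' b']].
  - by rewrite fsbig_set1 /= !indicE !mem_set// mulr1.
  - move=> /= [[ab' abE] nab]; rewrite !indicE.
    have [/set_mem Ua'|_] := boolP (a' \in U); last by rewrite mul0r.
    have [/set_mem Vb'|_] := boolP (b' \in V); last by rewrite mulr0.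
    have aa' : a' = a.
      apply: rU; rewrite ?inE//.
      by rewrite -(gpd_rngM ab) -abE gpd_rngM.
    have bb' : b' = b.
      by apply: rV; rewrite ?inE//; rewrite -ab -ab' aa'.
    by case: nab; rewrite aa' bb'.
rewrite fsbig1// => -[a b] /= [ab abc]; rewrite !indicE.
have [/set_mem Ua|_] := boolP (a \in U); last by rewrite mul0r.
have [/set_mem Vb|_] := boolP (b \in V); last by rewrite mulr0.
by move: nc; rewrite notin_setE; case; exists a, b.
Qed.

Lemma star_indic (U : set G) (fU : finite_set U) :
  star (fsupp_indic C fU) = fsupp_indic C (bisection_inv_finite fU).
Proof.
apply/fsuppP => c; rewrite [LHS]/= [RHS]/= !indicE rmorph_nat.
congr (_%:R); congr nat_of_bool; apply/idP/idP => /set_mem.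
  by move=> Uc; apply/mem_set; exists (gpd_inv c) => //; exact: gpd_invK.
by move=> [a Ua <-]; apply/mem_set; rewrite gpd_invK.
Qed.

End SteinbergAlgebra.

Record hilbert (R : realType) := Hilbert {
  hilbert_space :> completeNormedModType R[i];
  inner : {dot hilbert_space for Num.conj};
  normE_inner : forall x, `|x| ^+ 2 = inner x x
}.

Section OperatorNorm.
Variables (R : realType) (H : hilbert R).

Definition opnorm (T : H -> H) : \bar R :=
  ereal_sup [set (complex.Re `|T x|)%:E | x in [set x : H | `|x| <= 1]].

End OperatorNorm.

Section FullNorm.
Variables (R : realType) (G : groupoidType).
Local Notation C := R[i].
Local Notation Cc := (Cc R G).

Record star_representation (H : hilbert R) (rho : Cc -> H -> H) : Prop := {
  star_rep_linear_op : forall f, linear (rho f);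
  star_rep_bounded : forall f, exists M : R,
    forall x, `|rho f x| <= M%:C * `|x|;
  star_rep_linear : forall a f g x, rho (a *: f + g) x = a *: rho f x + rho g x;
  star_rep_mul : forall f g x, rho (convolution f g) x = rho f (rho g x);
  star_rep_star : forall f x y, inner H (rho f x) y = inner H x (rho (star f) y)
}.

(* The range of the supremum is a set of extended reals, although H ranges    *)
(* over a large type. The supremum is finite (full_norm_fin_num), so that no  *)
(* information is lost in max_norm.                                           *)
Definition full_norm (f : Cc) : \bar R :=
  ereal_sup [set v | exists (H : hilbert R) (rho : Cc -> H -> H),
    star_representation rho /\ v = opnorm (rho f)].

Definition max_norm (f : Cc) : R := fine (full_norm f).

End FullNorm.

(* Only used to see that representations exist, i.e., that full_norm >= 0.    *)
Section ZeroHilbert.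
Variable R : realType.
Local Notation C := R[i].

Definition zero_seminorm : seminorm C^o.
Proof.
exists (fun=> 0) => [x y|a x]; first by rewrite addr0.
by rewrite mulr0.
Defined.

Lemma zero_space_eq0 (x : completion zero_seminorm) : x = 0.
Proof.
apply/completion_norm_eq0; congr (_%:C); apply/cvg_lim => //.
exact: (cvg_cst (0 : R)).
Qed.

Definition zero_form (x y : completion zero_seminorm) : C := 0.

Fact zero_form_bilinear : bilinear_for
  (GRing.Scale.Law.clone _ _ ( *%R : C -> C -> C) _)
  (GRing.Scale.Law.clone _ _ (Num.conj \; *%R : C -> C -> C) _) zero_form.
Proof. by split=> u a x y /=; rewrite mulr0 addr0. Qed.

HB.instance Definition _ := bilinear_isBilinear.Build C
  (completion zero_seminorm) (completion zero_seminorm) C _ _ zero_form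
  zero_form_bilinear.
Fact zero_form_herm x y : zero_form x y = (-1) ^+ false * Num.conj (zero_form y x).
Proof. by rewrite /zero_form rmorph0 mulr0. Qed.
HB.instance Definition _ := @isHermitianSesquilinear.Build C
  (completion zero_seminorm) false Num.conj zero_form zero_form_herm.
Fact zero_form_dot x : x != 0 -> 0 < zero_form x x.
Proof. by rewrite (zero_space_eq0 x) eqxx. Qed.
HB.instance Definition _ := @isDotProduct.Build C
  (completion zero_seminorm) zero_form zero_form_dot.

Definition zero_hilbert : hilbert R.
Proof.
exists (completion zero_seminorm) zero_form => x.
by rewrite (zero_space_eq0 x) normr0 expr0n.
Defined.

End ZeroHilbert.

Section FullNormTheory.
Variables (R : realType) (G : groupoidType).
Local Notation C := R[i].
Local Notation Cc := (Cc R G).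

Lemma opnorm_ge0 (H : hilbert R) (T : H -> H) : (0 <= opnorm T)%E.
Proof.
apply: (@le_trans _ _ (complex.Re `|T 0|)%:E).
  by rewrite lee_fin Re_nneg.
by apply: ereal_sup_ubound; exists 0 => //=; rewrite normr0.
Qed.

Lemma full_norm_ge0 (f : Cc) : (0 <= full_norm f)%E.
Proof.
apply: le_trans (@opnorm_ge0 (zero_hilbert R) (fun=> 0)) _.
apply: ereal_sup_ubound; exists (zero_hilbert R), (fun _ _ => 0); split=> //.
split=> // [g a x y|g|a g h x].
- by rewrite scaler0 addr0.
- by exists 0 => x; rewrite normr0 mul0r.
- by rewrite scaler0 addr0.
Qed.

Section Contraction.
Variables (H : hilbert R) (rho : Cc -> H -> H) (hrho : star_representation rho).

Definition point_mass (a : G) : Cc := fsupp_indic C (finite_set1 a).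

Lemma fsupp_indic_eq (U V : set G) (fU : finite_set U) (fV : finite_set V) :
  U = V -> fsupp_indic C fU = fsupp_indic C fV.
Proof. by move=> UV; apply/fsuppP => x /=; rewrite UV. Qed.

Lemma bisection1 (a : G) : bisection [set a].
Proof. by split=> x y; rewrite !inE => -> ->. Qed.

Lemma convolution_point_mass a b :
  composable a b -> convolution (point_mass a) (point_mass b) = point_mass (gpd_mul a b).
Proof.
move=> ab; rewrite convolution_indic; try exact: bisection1.
apply: fsupp_indic_eq; apply/seteqP; split=> [_ [_ [_ [-> -> _ ->]]]//|_ ->].
by exists a, b.
Qed.

Lemma star_point_mass a : star (point_mass a) = point_mass (gpd_inv a).
Proof. by rewrite star_indic; apply: fsupp_indic_eq; rewrite /bisection_inv image_set1. Qed.

Lemma norm_point_mass_rep a x : `|rho (point_mass a) x| <= `|x|.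
Proof.
pose P := rho (point_mass (gpd_src a)).
have ca : composable (gpd_inv a) a by rewrite /composable gpd_srcV.
have dP : convolution (star (point_mass a)) (point_mass a) = point_mass (gpd_src a).
  by rewrite star_point_mass convolution_point_mass.
have sP : star (point_mass (gpd_src a)) = point_mass (gpd_src a).
  by rewrite star_point_mass -gpd_rngV gpd_inv_rng.
have PP : convolution (point_mass (gpd_src a)) (point_mass (gpd_src a)) =
    point_mass (gpd_src a).
  rewrite convolution_point_mass -gpd_rngV; last first.
    by rewrite /composable gpd_src_rng gpd_rng_rng.
  by rewrite -{1}[gpd_rng _]gpd_rng_rng gpd_mul_rng.
have innerP : inner H (P x) (P x) = inner H x (P x).
  by rewrite (star_rep_star hrho) sP -(star_rep_mul hrho) PP.
have -> : `|rho (point_mass a) x| = `|P x|.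
  apply/eqP; rewrite -(@eqrXn2 _ 2%N) ?normr_ge0// !normE_inner innerP.
  by rewrite (star_rep_star hrho) -(star_rep_mul hrho) dP.
rewrite -(@ler_pXn2r _ 2%N) ?nnegrE ?normr_ge0//.
have -> : `|x| ^+ 2 = `|x - P x| ^+ 2 + `|P x| ^+ 2.
  rewrite !normE_inner -{1 2}(subrK (P x) x).
  apply: hnormDd.
  by apply/eqP; rewrite linearBl subr_eq0; apply/eqP; exact: (esym innerP).
by rewrite lerDr exprn_ge0.
Qed.

End Contraction.

Lemma fsupp_sum (f : Cc) :
  f = \sum_(a <- finmap.enum_fset (fset_set (f @^-1` [set~ 0]))) f a *: point_mass a.
Proof.
apply/fsuppP => x.
have -> : forall s : seq G, (\sum_(a <- s) f a *: point_mass a) x =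
    \sum_(a <- s) f a * (x == a)%:R.
  move=> s; elim: s => [|a s IH]; first by rewrite !big_nil.
  rewrite !big_cons -IH [LHS]/= ; congr (_ * _ + _).
  by rewrite /= indicE; congr ((_ : bool)%:R); apply/idP/eqP => [/set_mem|/mem_set].
have [fx0|/eqP fx0] := eqVneq (f x) 0.
  rewrite fx0 big1// => a _; have [<-|_] := eqVneq x a; last by rewrite mulr0.
  by rewrite fx0 mul0r.
rewrite (finmap.big_fsetD1 x)/=; last by rewrite in_fset_set ?mem_set//; exact: fsupp_finite.
rewrite eqxx mulr1 big_seq big1 ?addr0// => a.
by rewrite !inE => /andP[/negbTE ax _]; rewrite eq_sym ax mulr0.
Qed.

Definition l1_norm (f : Cc) : R :=
  \sum_(a <- finmap.enum_fset (fset_set (f @^-1` [set~ 0]))) complex.Re `|f a|.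

Lemma norm_rep_le (H : hilbert R) (rho : Cc -> H -> H) f x :
  star_representation rho -> `|rho f x| <= (l1_norm f)%:C * `|x|.
Proof.
move=> hrho.
have rho0 : rho 0 x = 0.
  have := star_rep_linear hrho 1 0 0 x; rewrite scale1r addr0 scale1r.
  by move=> /eqP; rewrite -subr_eq subrr eq_sym => /eqP.
have rhoZ a g : rho (a *: g) x = a *: rho g x.
  by rewrite -[a *: g]addr0 (star_rep_linear hrho) rho0 addr0.
have rhoD g h : rho (g + h) x = rho g x + rho h x.
  by rewrite -[g in LHS]scale1r (star_rep_linear hrho) scale1r.
rewrite [in leLHS](fsupp_sum f) /l1_norm.
elim: (finmap.enum_fset _) => [|a s IH].
  by rewrite !big_nil rho0 normr0 mul0r.
rewrite !big_cons rhoD rhoZ rmorphD mulrDl (le_trans (ler_normD _ _))//.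
rewrite lerD// normrZ -[`|f a|]ReK_ge0//; apply: ler_wpM2l.
  by rewrite ReK_ge0.
exact: norm_point_mass_rep.
Qed.

Lemma full_norm_fin_num (f : Cc) : full_norm f \is a fin_num.
Proof.
rewrite ge0_fin_numE ?full_norm_ge0//.
apply: (@le_lt_trans _ _ (l1_norm f)%:E); last exact: ltry.
apply: ge_ereal_sup => _ [H [rho [hrho ->]]].
apply: ge_ereal_sup => _ [x /= x1 <-]; rewrite lee_fin -lecR ReK_ge0//.
rewrite (le_trans (norm_rep_le f x hrho))// ler_piMr//.
rewrite lecR /l1_norm sumr_ge0// => a _; exact: Re_nneg.
Qed.

Lemma max_normE (f : Cc) : (max_norm f)%:E = full_norm f.
Proof. by rewrite fineK// full_norm_fin_num. Qed.

Lemma max_norm_ub (H : hilbert R) (rho : Cc -> H -> H) f x :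
  star_representation rho -> `|x| <= 1 -> complex.Re `|rho f x| <= max_norm f.
Proof.
move=> hrho x1; rewrite -lee_fin max_normE.
apply: (@le_trans _ _ (opnorm (rho f))).
  by apply: ereal_sup_ubound; exists x.
by apply: ereal_sup_ubound; exists H, rho.
Qed.

Lemma max_norm_le (f : Cc) (M : R) :
  (forall (H : hilbert R) (rho : Cc -> H -> H) x, star_representation rho ->
    `|x| <= 1 -> complex.Re `|rho f x| <= M) -> max_norm f <= M.
Proof.
move=> fM; rewrite -lee_fin max_normE.
apply: ge_ereal_sup => _ [H [rho [hrho ->]]].
by apply: ge_ereal_sup => _ [x /= x1 <-]; rewrite lee_fin fM.
Qed.

Lemma max_norm_ge0 (f : Cc) : 0 <= max_norm f.
Proof. by rewrite -lee_fin max_normE full_norm_ge0. Qed.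

Fact max_normD (f g : Cc) : max_norm (f + g) <= max_norm f + max_norm g.
Proof.
apply: max_norm_le => H rho x hrho x1.
apply: le_trans (lerD (max_norm_ub f hrho x1) (max_norm_ub g hrho x1)).
rewrite -lecR rmorphD /= !ReK_ge0// -[f in leLHS]scale1r.
by rewrite (star_rep_linear hrho) scale1r ler_normD.
Qed.

Let max_normZ_le (a : C) (f : Cc) : max_norm (a *: f) <= complex.Re `|a| * max_norm f.
Proof.
apply: max_norm_le => H rho x hrho x1.
have rho0 : rho 0 x = 0.
  have := star_rep_linear hrho 1 0 0 x; rewrite scale1r addr0 scale1r.
  by move=> /eqP; rewrite -subr_eq subrr eq_sym => /eqP.
rewrite -[a *: f]addr0 (star_rep_linear hrho) rho0 addr0 normrZ.
rewrite -lecR ReK_ge0 ?mulr_ge0// rmorphM /= (ReK_ge0 (normr_ge0 a)) ler_wpM2l//.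
by rewrite -[leLHS]ReK_ge0// lecR max_norm_ub.
Qed.

Fact max_normZ (a : C) (f : Cc) : max_norm (a *: f) = complex.Re `|a| * max_norm f.
Proof.
apply/eqP; rewrite eq_le max_normZ_le andTb.
have [->|a0] := eqVneq a 0; first by rewrite normr0 mul0r max_norm_ge0.
have na0 : 0 < complex.Re `|a|.
  by rewrite -ltcR (ReK_ge0 (normr_ge0 a)) normr_gt0.
rewrite mulrC -ler_pdivlMr// -[f in leLHS](scalerK a0).
apply: le_trans (max_normZ_le _ _) _; rewrite mulrC ler_wpM2l ?max_norm_ge0//.
by rewrite -lecR ReK_ge0// normfV fmorphV /= (ReK_ge0 (normr_ge0 a)).
Qed.

Definition max_seminorm : seminorm Cc := Seminorm max_normD max_normZ.

Definition full_Cstar := completion max_seminorm.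
HB.instance Definition _ := CompleteNormedModule.on full_Cstar.

Definition Cc_to_Cstar (f : Cc) : full_Cstar := to_completion max_seminorm f.

End FullNormTheory.

Section FullGroupRepresentation.
Variables (R : realType) (G : groupoidType).
Local Notation C := R[i].

(* The underlying vector space of the complex group ring of the full group.   *)
Definition full_group_ring := fsupp C (full_group G).
HB.instance Definition _ := GRing.Lmodule.on full_group_ring.

Lemma full_group_finite (U : full_group G) : finite_set (val U).
Proof. by have /set_mem[] := valP U. Qed.

(* The linear extension of \delta_U |-> 1_U: see full_group_rep_delta. That it *)
(* respects products and adjoints is full_group_rep_mul/full_group_rep_star.  *)
Definition full_group_rep (x : full_group_ring) : Cc R G :=
  \sum_(U \in [set: full_group G]) x U *: fsupp_indic C (full_group_finite U).

Lemma full_group_rep_delta (U : full_group G) :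
  full_group_rep (fsupp_indic C (finite_set1 U)) =
  fsupp_indic C (full_group_finite U).
Proof.
rewrite /full_group_rep -(@fsbig_widen _ _ 0 _ [set U])//.
  by rewrite fsbig_set1 /= indicE mem_set// scale1r.
by move=> V [_ /= VU]; rewrite indicE memNset// scale0r.
Qed.

Lemma full_group_rep_mul (U V : full_group G) :
  convolution (fsupp_indic C (full_group_finite U))
    (fsupp_indic C (full_group_finite V)) =
  fsupp_indic C (full_group_finite (full_group_mul U V)).
Proof.
have /set_mem[_ bU _ _] := valP U; have /set_mem[_ bV _ _] := valP V.
by rewrite convolution_indic//; exact: fsupp_indic_eq.
Qed.

Lemma full_group_rep_star (U : full_group G) :
  star (fsupp_indic C (full_group_finite U)) =
  fsupp_indic C (full_group_finite (full_group_inv U)).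
Proof. by rewrite star_indic; exact: fsupp_indic_eq. Qed.

End FullGroupRepresentation.

(* Main.v *)
Require Import Defs.
From HB Require Import structures.
From mathcomp Require Import all_boot all_order all_algebra.
From mathcomp Require Import all_classical all_reals all_analysis.
From mathcomp Require Import complex.
Import Order.TTheory GRing.Theory Num.Theory.
Import numFieldNormedType.Exports.

Set Implicit Arguments.
Unset Strict Implicit.
Unset Printing Implicit Defensive.

Local Open Scope classical_set_scope.
Local Open Scope ring_scope.
Local Open Scope complex_scope.

(** If G is a group, every singleton is a full bisection, so the span of the
    functions 1_U is already all of C_c(G), which is dense in C*(G)
    (group_full_group_rep_surj).

    If G has two distinct units d and e, let C_c(G) act on the
    finite-dimensional Hilbert space l^2(G^(0)) by
      (f . x)(v) = \sum_(r(a) = v) f(a) x(s(a))                    (unit_rep).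
    A full bisection U acts as the permutation matrix of s(a) |-> r(a), a in U,
    hence fixes the constant vector 1. So pi(x) maps 1 to a multiple of 1 for
    every x in C F(G), and by continuity the same holds for every element of the
    closure. But 1_{d} maps 1 to the basis vector at d, which is not constant
    since it vanishes at e; so 1_{d} is not in the closure.

    Quantitatively, f |-> (f . 1)(d) - (f . 1)(e) is a linear functional
    (unit_diff) that vanishes on pi(C F(G)), takes the value 1 at 1_{d}, and is
    bounded by a multiple of the full norm because unit_rep is a
    *-representation; so 1_{d} has positive distance to pi(C F(G))
    (full_group_rep_away). The work lies in equipping l^2(G^(0)) with the
    structure of a Hilbert space and in checking that unit_rep is a
    *-representation, which reduces to rearranging finite sums over G. *)

(** * The finite-dimensional Hilbert space over a finite index set *)

Section Euclidean.
Variables (R : realType) (I : finType).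
Local Notation C := R[i].

(** A named copy of the finite functions, to carry the l^2 norm and its
    topology. *)
Definition euclidean := {ffun I -> C^o}.
HB.instance Definition _ := Vector.on euclidean.

Implicit Types x y : euclidean.

Definition edot x y : C := \sum_i x i * Num.conj (y i : C).

Fact edot_bilinear : bilinear_for
  (GRing.Scale.Law.clone _ _ ( *%R : C -> C -> C) _)
  (GRing.Scale.Law.clone _ _ (Num.conj \; *%R : C -> C -> C) _) edot.
Proof.
split=> u a x y; rewrite /edot /= [in RHS]mulr_sumr -big_split /=;
  apply: eq_bigr => i _; rewrite !ffunE.
  by rewrite mulrDl -mulrA.
by rewrite rmorphD mulrDr rmorphM mulrCA.
Qed.

HB.instance Definition _ := bilinear_isBilinear.Build C
  euclidean euclidean C _ _ edot edot_bilinear.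

Fact edot_herm x y : edot x y = (-1) ^+ false * Num.conj (edot y x).
Proof.
rewrite mul1r rmorph_sum; apply: eq_bigr => i _.
rewrite rmorphM [RHS]mulrC; congr (_ * _); exact: esym (conjCK _).
Qed.
HB.instance Definition _ := @isHermitianSesquilinear.Build C
  euclidean false Num.conj edot edot_herm.

Lemma edot_sqr x : edot x x = \sum_i `|x i : C| ^+ 2.
Proof. by apply: eq_bigr => i _; rewrite normCK. Qed.

Fact edot_dot x : x != 0 -> 0 < edot x x.
Proof.
move=> x0; rewrite edot_sqr lt_def sumr_ge0 ?andbT => [|i _]; last first.
  exact: exprn_ge0.
apply: contra_neq x0 => /psumr_eq0P s0; apply/ffunP => i; rewrite ffunE.
by apply/eqP; rewrite -normr_eq0 -sqrf_eq0 s0// => j _; exact: exprn_ge0.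
Qed.
HB.instance Definition _ := @isDotProduct.Build C euclidean edot edot_dot.

Definition enorm x : C := sqrtC (edot x x).

Fact enormD x y : enorm (x + y) <= enorm x + enorm y.
Proof. exact: (triangle_lerif edot). Qed.

Fact enormZ (a : C) x : enorm (a *: x) = `|a| * enorm x.
Proof.
rewrite /enorm (dnormZ edot) sqrtCM ?nnegrE ?exprn_ge0 ?(dnorm_ge0 edot)//.
by rewrite sqrCK.
Qed.

Fact enorm_eq0 x : enorm x = 0 -> x = 0.
Proof. by move/eqP; rewrite (sqrt_dnorm_eq0 edot) => /eqP. Qed.

HB.instance Definition _ := Lmodule_isNormed.Build C euclidean
  enormD enormZ enorm_eq0.

Lemma enormE x : `|x| ^+ 2 = edot x x.
Proof. exact: sqrtCK. Qed.

Lemma coord_le_norm x i : `|x i : C| <= `|x|.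
Proof.
rewrite -(@ler_pXn2r _ 2%N) ?nnegrE ?normr_ge0// enormE edot_sqr.
by rewrite (bigD1 i)//= lerDl sumr_ge0// => j _; exact: exprn_ge0.
Qed.

Definition ebasis i : euclidean := [ffun j => (j == i)%:R].

Lemma euclidean_sum x : x = \sum_i (x i : C) *: ebasis i.
Proof.
apply/ffunP => j; rewrite sum_ffunE (bigD1 j)//= big1 => [|i ij].
  by rewrite !ffunE eqxx addr0 [RHS]mulr1.
by rewrite !ffunE eq_sym (negbTE ij) [LHS]mulr0.
Qed.

(** Expanding x in the basis, each coordinate of x is at most its norm; so a
    linear map out of a finite-dimensional space is bounded by the sum of the
    norms of the images of the basis vectors. *)
Lemma norm_linear_le (V : normedModType C) (T : euclidean -> V) :
  linear T -> forall x, `|T x| <= (\sum_i `|T (ebasis i)|) * `|x|.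
Proof.
move=> lT x; pose L : {linear euclidean -> V} :=
  HB.pack T (GRing.isLinear.Build C euclidean V _ T lT).
rewrite {1}(euclidean_sum x) -[T]/(L : _ -> _) raddf_sum mulr_suml.
rewrite (le_trans (ler_norm_sum _ _ _))// ler_sum// => i _.
by rewrite [X in `|X|](linearZ_LR L) normrZ mulrC ler_wpM2l ?coord_le_norm.
Qed.

Lemma norm_ebasis i : `|ebasis i| = 1.
Proof.
apply/eqP; rewrite -(@eqrXn2 _ 2%N) ?normr_ge0// enormE edot_sqr expr1n.
rewrite (bigD1 i)//= big1 => [|j ji]; rewrite ffunE.
  by rewrite eqxx normr1 expr1n addr0.
by rewrite (negbTE ji) normr0 expr0n.
Qed.

Lemma norm_le_sum x : `|x| <= \sum_i `|x i : C|.
Proof.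
rewrite {1}(euclidean_sum x) (le_trans (ler_norm_sum _ _ _))// ler_sum// => i _.
by rewrite normrZ norm_ebasis mulr1.
Qed.

(** The real and imaginary parts of the coordinates: completeness is inherited
    from that of R through these real coordinates, which control the norm from
    both sides (rcoord_le and norm_le_rcoord). *)
Definition rcoord (p : I * bool) x : R :=
  let z : C := x p.1 in if p.2 then complex.Re z else complex.Im z.

Lemma rcoordB p x y : rcoord p (x - y) = rcoord p x - rcoord p y.
Proof.
case: p => i b; rewrite /rcoord /= !ffunE.
by case: b; case: (x i) => ? ?; case: (y i) => ? ?.
Qed.

Lemma rcoord_le p x : `|rcoord p x| <= complex.Re `|x|.
Proof.
case: p => i b; rewrite -lecR ReK_ge0 ?normr_ge0//.
apply: le_trans (coord_le_norm x i); rewrite /rcoord /=.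
case: (x i) => u v; rewrite normc_def /= lecR -sqrtr_sqr ler_wsqrtr//.
by case: b; rewrite ?lerDl ?lerDr sqr_ge0.
Qed.

Lemma norm_le_rcoord x : complex.Re `|x| <= \sum_p `|rcoord p x|.
Proof.
rewrite -lecR ReK_ge0 ?normr_ge0// (le_trans (norm_le_sum x))//.
rewrite -(pair_bigA _ (fun i b => `|rcoord (i, b) x|)) rmorph_sum /=.
apply: ler_sum => i _; rewrite big_bool /rcoord /=.
case: (x i) => u v; rewrite normc_def lecR /=.
(* sqrt (u^2 + v^2) <= |u| + |v|, compared after squaring. *)
rewrite -(@ler_pXn2r _ 2%N) ?nnegrE ?sqrtr_ge0 ?addr_ge0//.
rewrite sqr_sqrtr ?addr_ge0 ?sqr_ge0// sqrrD !real_normK ?num_real//.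
by rewrite addrAC lerDl mulrn_wge0// mulr_ge0.
Qed.

Fact euclidean_complete (F : set_system euclidean) :
  ProperFilter F -> cauchy F -> cvg F.
Proof.
move=> FF Fc.
have Fp p : exists l : R, forall e, 0 < e ->
    \forall x \near F, `|l - rcoord p x| < e.
  have [l Fl] : exists l : R, rcoord p @ F --> l.
    apply/cvg_ex/cauchy_cvgP/cauchy_exP => e e0.
    have eC0 : 0 < e%:C :> C by rewrite ltcR.
    have /cauchyP /(_ _ eC0) [x Fx] := Fc.
    exists (rcoord p x).
    suff : F [set y | `|rcoord p x - rcoord p y| < e] by [].
    apply: filterS Fx => y; rewrite -ball_normE /= => xy.
    rewrite -rcoordB; apply: le_lt_trans (rcoord_le _ _) _.
    by rewrite -ltcR ReK_ge0.
  by exists l => e e0; move/cvgrPdist_lt : Fl; exact.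
have {Fp} [l Fl] := choice Fp.
pose z : euclidean := [ffun i => (l (i, true) +i* l (i, false)) : C].
have zl p : rcoord p z = l p by case: p => i []; rewrite /rcoord /= ffunE.
apply/cvg_ex; exists z; apply/fcvgrPdist_lt => _ /gt0_complex[r r0 ->].
(* N times r / (N + 1) is less than r, also for N = 0. *)
pose e := r / (#|{: I * bool}|.+1)%:R.
have e0 : 0 < e by rewrite divr_gt0.
have H : \forall x \near F, forall p, `|l p - rcoord p x| < e.
  apply: filter_forall => p; exact: Fl.
apply: filterS H => x zx.
rewrite -[ltLHS]ReK_ge0// ltcR (le_lt_trans (norm_le_rcoord _))//.
apply: (@le_lt_trans _ _ (\sum_(p : I * bool) e)).
  by apply: ler_sum => p _; rewrite rcoordB zl ltW.
rewrite sumr_const -mulr_natr /e -mulrA gtr_pMr//.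
by rewrite mulrC ltr_pdivrMr// mul1r ltr_nat.
Qed.
HB.instance Definition _ :=
  Uniform_isComplete.Build euclidean euclidean_complete.

Definition euclidean_hilbert : hilbert R :=
  @Hilbert R euclidean edot enormE.

End Euclidean.

(** * Finite linear combinations *)

Section LinearCombination.
Variables (K : numFieldType) (T : choiceType).
Implicit Types (f g : fsupp K T).

(** The linear extension of t |-> w t to finitely supported functions. The
    representation of the full group ring and the matrix coefficients of
    unit_rep are both of this form. *)
Definition lincomb (V : lmodType K) f (w : T -> V) : V :=
  \sum_(t \in [set: T]) (f t : K) *: w t.

Lemma lincombE (V : lmodType K) f (w : T -> V) (A : set T) :
  (forall t, ~ A t -> f t = 0) -> lincomb f w = \sum_(t \in A) (f t : K) *: w t.
Proof.
move=> fA; rewrite /lincomb -(@fsbig_widen _ _ 0 _ A setT)// => t [_ /= nAt].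
by rewrite fA// scale0r.
Qed.

Lemma fsupp_out f t : ~ (f @^-1` [set~ 0]) t -> f t = 0.
Proof. exact: contrapT. Qed.

Lemma lincomb_fset (V : lmodType K) f (w : T -> V) :
  lincomb f w =
  \sum_(t <- finmap.enum_fset (fset_set (f @^-1` [set~ 0]))) (f t : K) *: w t.
Proof.
by rewrite (lincombE _ (@fsupp_out f)) fsbig_finite//; exact: fsupp_finite.
Qed.

Lemma lincombZDl (V : lmodType K) a f g (w : T -> V) :
  lincomb (a *: f + g) w = a *: lincomb f w + lincomb g w.
Proof.
(* The support of the combination may be smaller than either support, so all
   three sums are taken over the union. *)
pose A := f @^-1` [set~ 0] `|` g @^-1` [set~ 0].
have fA : finite_set A by rewrite finite_setU; split; exact: fsupp_finite.
have f0 t : ~ A t -> f t = 0.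
  by move=> nA; apply: fsupp_out => ft; apply: nA; left.
have g0 t : ~ A t -> g t = 0.
  by move=> nA; apply: fsupp_out => gt; apply: nA; right.
have hE t : (a *: f + g) t = a * f t + g t by [].
have h0 t : ~ A t -> (a *: f + g) t = 0.
  by move=> nA; rewrite hE f0// g0// mulr0 addr0.
rewrite (lincombE _ f0) (lincombE _ g0) (lincombE _ h0) !fsbig_finite//.
rewrite scaler_sumr -big_split; apply: eq_bigr => t _.
by rewrite hE scalerDl scalerA.
Qed.

Lemma linear_lincomb (V W : lmodType K) (L : {linear V -> W}) f (w : T -> V) :
  L (lincomb f w) = lincomb f (L \o w).
Proof.
rewrite !lincomb_fset linear_sum; apply: eq_bigr => t _.
exact: linearZ.
Qed.

Lemma lincombZDr (V : lmodType K) f a (w w' : T -> V) :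
  lincomb f (fun t => a *: w t + w' t) = a *: lincomb f w + lincomb f w'.
Proof.
rewrite !lincomb_fset scaler_sumr -big_split /=; apply: eq_bigr => t _.
by rewrite scalerDr !scalerA mulrC.
Qed.

Lemma lincomb_sumr (V : lmodType K) (I : finType) f (w : I -> T -> V) :
  \sum_i lincomb f (w i) = lincomb f (fun t => \sum_i w i t).
Proof.
under eq_bigr do rewrite lincomb_fset.
rewrite exchange_big lincomb_fset; apply: eq_bigr => t _.
by rewrite scaler_sumr.
Qed.

Lemma lincomb_scalel f (k : K) (w : T -> K^o) :
  lincomb f w * k = lincomb f (fun t => w t * k : K^o).
Proof.
rewrite !lincomb_fset mulr_suml; apply: eq_bigr => t _.
exact: esym (mulrA _ _ _).
Qed.

Lemma lincomb_indic (V : lmodType K) (U : set T) (fU : finite_set U)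
    (w : T -> V) : lincomb (fsupp_indic K fU) w = \sum_(t \in U) w t.
Proof.
rewrite (@lincombE _ _ _ U) => [|t nUt]; last by rewrite /= indicE memNset.
by apply: eq_fsbigr => t Ut; rewrite /= indicE Ut scale1r.
Qed.

End LinearCombination.

(** * Sums over a groupoid *)

Section GroupoidSums.
Variables (R : realType) (G : groupoidType).
Local Notation C := R[i].
Implicit Types f g : Cc R G.

Lemma lincomb_point_mass f : lincomb f (@point_mass R G) = f.
Proof. by rewrite lincomb_fset; exact: esym (fsupp_sum f). Qed.

(** The linear extension of w is applied to f * g by summing over c = a b
    first: each composable pair (a, b) of the supports occurs for exactly one
    c. All sums are cut down to finite sets so that they can be exchanged. *)
Lemma lincomb_convolution (V : lmodType C) f g (w : G -> V) :
  lincomb (convolution f g) w =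
  lincomb f (fun a => lincomb g (fun b =>
    (gpd_src a == gpd_rng b)%:R *: w (gpd_mul a b))).
Proof.
pose A := f @^-1` [set~ 0]; pose B := g @^-1` [set~ 0].
have fA : finite_set A by exact: fsupp_finite.
have fB : finite_set B by exact: fsupp_finite.
pose M := (fun p : G * G => gpd_mul p.1 p.2) @` (A `*` B).
have fAB : finite_set (A `*` B) by exact: finite_setX.
have fM : finite_set M by exact: finite_image.
have convE c : convolution f g c = \sum_(p \in A `*` B)
    f p.1 * g p.2 *
    ((gpd_src p.1 == gpd_rng p.2) && (gpd_mul p.1 p.2 == c))%:R.
  rewrite [LHS]/= /convolution_fun; set S := [set p | _].
  rewrite -[LHS](@fsbig_widen _ _ 0 _ (S `&` (A `*` B)) S) => [|p []//|p].
    rewrite -[RHS](@fsbig_widen _ _ 0 _ (S `&` (A `*` B)))=> [|p []//|p].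
      apply: eq_fsbigr => p /set_mem[[/= -> ->] _].
      by rewrite !eqxx mulr1.
    move=> [ABp] nS /=; case: eqP; last by rewrite mulr0.
    move=> sr; case: eqP; last by rewrite mulr0.
    by move=> mc; case: nS.
  move=> [Sp nAB] /=.
  have [->|/eqP fp] := eqVneq (f p.1) 0; first by rewrite mul0r.
  have [->|/eqP gp] := eqVneq (g p.2) 0; first by rewrite mulr0.
  by case: nAB.
have conv0 c : ~ M c -> convolution f g c = 0.
  move=> nM; rewrite convE fsbig1// => p ABp.
  have [cM|] := eqVneq (gpd_mul p.1 p.2) c; last by rewrite andbF mulr0.
  by case: nM; exists p.
rewrite (lincombE _ conv0) (lincombE _ (@fsupp_out _ _ f)) -/A.
transitivity (\sum_(c \in M) \sum_(p \in A `*` B)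
    (f p.1 * g p.2 *
    ((gpd_src p.1 == gpd_rng p.2) && (gpd_mul p.1 p.2 == c))%:R) *: w c).
  by apply: eq_fsbigr => c _; rewrite convE !fsbig_finite// scaler_suml.
rewrite exchange_fsbig//.
transitivity (\sum_(a \in A) \sum_(b \in B)
  (f a * g b * (gpd_src a == gpd_rng b)%:R) *: w (gpd_mul a b)).
  rewrite [RHS]pair_fsbig//; apply: eq_fsbigr => p /set_mem ABp.
  rewrite -(@fsbig_widen _ _ 0 _ [set gpd_mul p.1 p.2]).
  - by rewrite fsbig_set1 eqxx andbT.
  - by move=> _ ->; exists p.
  - move=> c [_ /= /eqP]; rewrite eq_sym => /negbTE ->.
    by rewrite andbF mulr0 scale0r.
apply: eq_fsbigr => a _; rewrite (lincombE _ (@fsupp_out _ _ g)).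
rewrite !fsbig_finite// scaler_sumr; apply: eq_bigr => b _.
by rewrite !scalerA.
Qed.

Lemma lincomb_star f (w : G -> C^o) :
  lincomb (star f) w =
  Num.conj (lincomb f (fun a => Num.conj (w (gpd_inv a) : C) : C^o) : C).
Proof.
rewrite /lincomb [LHS](@reindex_fsbigT _ _ _ _ _ (@gpd_inv G)); last first.
  by exists (@gpd_inv G); exact: gpd_invK.
rewrite -[X in Num.conj X]/(lincomb f _) lincomb_fset rmorph_sum.
rewrite -fsbig_finite; last exact: fsupp_finite.
rewrite -[LHS](@fsbig_widen _ _ 0 _ (f @^-1` [set~ 0])) => [|//|a [_ nfa]].
  apply: eq_fsbigr => a _; rewrite [star f _]/= gpd_invK rmorphM.
  by congr (_ * _); exact: esym (conjCK _).
by rewrite /= gpd_invK (fsupp_out nfa) rmorph0 scale0r.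
Qed.

(** A full bisection contains exactly one element with a given range. This is
    what makes its action fix the constant vector. *)
Lemma lincomb_full_bisection (V : lmodType C) (U : full_group G) (w : G -> V) :
  lincomb (fsupp_indic C (full_group_finite U)) (w \o @gpd_rng G) =
  \sum_(e \in @gpd_units G) w e.
Proof.
have /set_mem[_ [rU _] rUE _] := valP U.
by rewrite lincomb_indic -rUE fsbig_image.
Qed.

End GroupoidSums.

(** * The full norm *)

Section MaxNorm.
Variables (R : realType) (G : groupoidType).
Local Notation C := R[i].

(** The defining bound of the full norm concerns the unit ball; rescale x. *)
Lemma norm_rep_le_max_norm (H : hilbert R) (rho : Cc R G -> H -> H) f x :
  star_representation rho -> `|rho f x| <= (max_norm f)%:C * `|x|.
Proof.
move=> hrho; have lrho := star_rep_linear_op hrho f.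
have r0 : rho f 0 = 0.
  have := lrho 1 0 0; rewrite scaler0 addr0 scale1r => /eqP.
  by rewrite -subr_eq subrr eq_sym => /eqP.
have rhoZ a y : rho f (a *: y) = a *: rho f y.
  by rewrite -[a *: y]addr0 lrho r0 addr0.
have [->|x0] := eqVneq x 0; first by rewrite r0 !normr0 mulr0.
have nx : 0 < `|x| by rewrite normr_gt0.
rewrite -ler_pdivrMr// mulrC -[_^-1]ger0_norm ?invr_ge0// -normrZ -rhoZ.
rewrite -[leLHS]ReK_ge0// lecR; apply: max_norm_ub => //.
by rewrite normrZ ger0_norm ?invr_ge0// mulVf ?gt_eqF.
Qed.

Lemma norm_Cc_to_Cstar_sub (f g : Cc R G) :
  `|Cc_to_Cstar f - Cc_to_Cstar g| = (max_norm (f - g))%:C.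
Proof. by rewrite /Cc_to_Cstar -raddfB norm_to_completion. Qed.

Lemma full_group_repE (x : full_group_ring R G) :
  full_group_rep x = lincomb x (fun U => fsupp_indic C (full_group_finite U)).
Proof. by []. Qed.

End MaxNorm.

(** In a group, the point masses, which span C_c(G), are the images of the
    basis elements of the group ring given by singletons. *)
Lemma group_full_group_rep_surj (R : realType) (G : groupoidType) :
  is_group G -> range (@full_group_rep R G) = setT.
Proof.
move=> [e eG]; have unit1 a : gpd_rng a = e /\ gpd_src a = e.
  have H b : gpd_rng b = e.
    have : gpd_units (gpd_rng b) by exists b.
    by rewrite eG.
  by rewrite -gpd_rngV !H.
have fb (a : G) : full_bisection [set a].
  split=> //; first exact: bisection1.
    by rewrite image_set1 eG (unit1 a).1.
  by rewrite image_set1 eG (unit1 a).2.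
pose U a : full_group G := SigSub (mem_set (fb a)).
rewrite -subTset => f _.
pose L : {linear full_group_ring R G -> Cc R G} := HB.pack (@full_group_rep R G)
  (GRing.isLinear.Build R[i] (full_group_ring R G) (Cc R G) _
    (@full_group_rep R G) (fun a x y => lincombZDl a x y _)).
pose delta a : full_group_ring R G := fsupp_indic R[i] (finite_set1 (U a)).
exists (lincomb f delta) => //.
rewrite -[LHS]/(L _) (linear_lincomb L) -[RHS]lincomb_point_mass.
congr (lincomb f _); apply/funext => a /=; rewrite full_group_rep_delta.
exact: fsupp_indic_eq.
Qed.

(** * The representation on the unit space *)

Section UnitRepresentation.
Variables (R : realType) (G : groupoidType) (I : finType) (u : G -> I).
(* The units are a finite subset of G; u relabels them by a finite type, over
   which the Hilbert space is defined. *)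
Hypothesis u_inj : set_inj (@gpd_units G) u.
Local Notation C := R[i].
Local Notation H := (euclidean_hilbert R I).
Implicit Types f g : Cc R G.

Definition unit_rep f (x : H) : H :=
  [ffun i => lincomb f (fun a =>
    (u (gpd_rng a) == i)%:R * (x : euclidean R I) (u (gpd_src a)) : C^o)].

Lemma u_src_rng a b :
  (u (gpd_src a) == u (gpd_rng b)) = (gpd_src a == gpd_rng b).
Proof.
apply/eqP/eqP => [|->//]; apply: u_inj; apply/mem_set; last by exists b.
by rewrite -gpd_rngV; exists (gpd_inv a).
Qed.

(** Multiplicativity uses that r(ab) = r(a), s(ab) = s(b) and that the labels
    of s(a) and r(b) agree exactly when ab is defined. For the adjoint, both
    inner products are the sum over a of f(a) x(s(a)) times the conjugate of
    y(r(a)), as a |-> a^-1 exchanges range and source. *)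
Lemma unit_rep_star_representation : star_representation unit_rep.
Proof.
have lin f : linear (unit_rep f : euclidean R I -> euclidean R I).
  move=> a x y; apply/ffunP => i; rewrite !ffunE.
  rewrite -[RHS]lincombZDr; congr (lincomb f _); apply/funext => b.
  by rewrite !ffunE mulrDr; congr (_ + _); exact: mulrCA.
split=> [f|f|a f g x|f g x|f x y].
- exact: lin.
- exists (complex.Re (\sum_i `|unit_rep f (ebasis R i)|)) => x.
  rewrite ReK_ge0; last by apply: sumr_ge0.
  exact: (norm_linear_le (lin f)).
- by apply/ffunP => i; rewrite !ffunE; exact: lincombZDl.
- apply/ffunP => i; rewrite !ffunE lincomb_convolution.
  congr (lincomb f _); apply/funext => a.
  rewrite ffunE [RHS]mulrC [RHS]lincomb_scalel.
  congr (lincomb g _); apply/funext => b.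
  rewrite (eq_sym (u (gpd_rng b))) u_src_rng.
  have [ab|_] := eqVneq; last by rewrite scale0r !mul0r.
  by rewrite scale1r mul1r gpd_rngM// gpd_srcM// mulrC.
- rewrite /= /edot.
  under eq_bigr do rewrite ffunE lincomb_scalel.
  rewrite lincomb_sumr.
  under [RHS]eq_bigr do rewrite ffunE lincomb_star conjCK mulrC lincomb_scalel.
  rewrite lincomb_sumr; congr (lincomb f _); apply/funext => a.
  rewrite (bigD1 (u (gpd_rng a)))//= eqxx mul1r big1 ?addr0 => [|i]; last first.
    by rewrite eq_sym => /negbTE ->; rewrite !mul0r.
  rewrite (bigD1 (u (gpd_src a)))//= gpd_rngV gpd_srcV eqxx mul1r.
  rewrite big1 ?addr0 => [|i]; last first.
    by rewrite eq_sym => /negbTE ->; rewrite mul0r rmorph0 mul0r.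
  by rewrite mulrC.
Qed.

End UnitRepresentation.

(** * Separating a point mass from the full group *)

Lemma unit_rng (G : groupoidType) (e : G) : gpd_units e -> gpd_rng e = e.
Proof. by move=> [a _ <-]; exact: gpd_rng_rng. Qed.

Lemma sum_delta (K : pzRingType) (T : choiceType) (A : set T) (c : T) :
  A c -> \sum_(t \in A) ((t == c)%:R : K) = 1.
Proof.
move=> Ac; rewrite -(@fsbig_widen _ _ 0 _ [set c]).
- by rewrite fsbig_set1 eqxx.
- by move=> _ ->.
- by move=> t [_ /= /eqP/negbTE ->].
Qed.

Section UnitFunctional.
Variables (R : realType) (G : groupoidType).
Hypothesis finite_units : finite_set (@gpd_units G).
Local Notation C := R[i].
Variables (d e : G).
Hypotheses (ud : gpd_units d) (ue : gpd_units e).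

(** The difference of the coordinates at d and e of f . 1, where 1 is the
    constant vector of l^2(G^(0)). It is written without reference to the
    representation, so that its linearity is immediate. *)
Definition unit_diff (f : Cc R G) : C^o :=
  lincomb f ((fun c => (c == d)%:R - (c == e)%:R : C^o) \o @gpd_rng G).

(** Each full bisection contributes 1 at d and 1 at e. *)
Lemma unit_diff_full_group_rep (x : full_group_ring R G) :
  unit_diff (full_group_rep x) = 0.
Proof.
pose L : {linear Cc R G -> C^o} := HB.pack unit_diff
  (GRing.isLinear.Build C (Cc R G) C^o _ unit_diff
    (fun a f g => lincombZDl a f g _)).
rewrite full_group_repE -[LHS]/(L _) (linear_lincomb L).
rewrite /lincomb fsbig1// => U _.
rewrite -[(_ \o _) _]/(unit_diff _) /unit_diff lincomb_full_bisection.
rewrite fsbig_finite//= sumrB -!fsbig_finite//.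
by rewrite !sum_delta// subrr scaler0.
Qed.

(** A difference of two coordinates of f . 1 is at most twice the norm of f . 1,
    and unit_rep is contractive for the full norm. *)
Lemma unit_diff_bounded : exists2 k : R, 0 <= k &
  forall f : Cc R G, `|unit_diff f : C| <= (k * max_norm f)%:C.
Proof.
pose I : finType := seq_sub (finmap.enum_fset (fset_set (@gpd_units G))).
have dI : d \in finmap.enum_fset (fset_set (@gpd_units G)).
  by rewrite in_fset_set ?inE.
(* The default value d of insubd is only taken outside the unit space. *)
pose u (a : G) : I := insubd (SeqSub dI) a.
have u_inj : set_inj (@gpd_units G) u.
  move=> a b /set_mem ua /set_mem ub /(congr1 val).
  by rewrite !insubdK//= in_fset_set ?inE.
have u_rng a c : gpd_units c -> (u (gpd_rng a) == u c) = (gpd_rng a == c).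
  move=> uc; apply/eqP/eqP => [|->//]; apply: u_inj; apply/mem_set => //.
  by exists a.
pose one : euclidean_hilbert R I := [ffun=> 1] : euclidean R I.
exists (2 * complex.Re `|one|); first by rewrite mulr_ge0// Re_nneg.
move=> f.
have -> : unit_diff f = (unit_rep u f one : euclidean R I) (u d) -
                        (unit_rep u f one : euclidean R I) (u e).
  rewrite !ffunE -[X in _ - X]scale1r -scaleNr addrC -lincombZDr.
  congr (lincomb f _); apply/funext => a /=.
  by rewrite !ffunE !mulr1 !u_rng// scaleN1r addrC.
have -> : (2 * complex.Re `|one| * max_norm f)%:C =
    (max_norm f)%:C * `|one| + (max_norm f)%:C * `|one|.
  rewrite -[in RHS](ReK_ge0 (normr_ge0 one)) -rmorphM -rmorphD; congr (_%:C).
  by rewrite -mulrA mulr_natl mulr2n (mulrC (max_norm f)).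
apply: le_trans (ler_normB _ _) _.
have rep := unit_rep_star_representation R u_inj.
by apply: lerD; apply: le_trans (coord_le_norm _ _) _;
  exact: (norm_rep_le_max_norm f one rep).
Qed.

(** unit_diff takes the value 1 on all these differences, so they cannot be
    small in the full norm. *)
Lemma full_group_rep_away : d <> e -> exists2 r : R, 0 < r &
  forall x : full_group_ring R G,
    r <= max_norm (point_mass R d - full_group_rep x).
Proof.
move=> /eqP/negbTE de; have [k k0 kP] := unit_diff_bounded.
have k1 : 0 < k + 1 by rewrite ltr_wpDl.
exists (k + 1)^-1; first by rewrite invr_gt0.
move=> x; have := kP (point_mass R d - full_group_rep x).
have -> : unit_diff (point_mass R d - full_group_rep x) = 1.
  rewrite addrC -scaleN1r [LHS]lincombZDl -!/(unit_diff _).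
  rewrite unit_diff_full_group_rep scaler0 add0r /unit_diff lincomb_indic.
  by rewrite fsbig_set1 /= (unit_rng ud) eqxx de subr0.
rewrite normr1 -(rmorph1 (real_complex R)) lecR => le1.
rewrite -[leLHS]mul1r ler_pdivrMr// (le_trans le1)// mulrC ler_wpM2l//.
  exact: max_norm_ge0.
by rewrite lerDl.
Qed.

End UnitFunctional.

Theorem theorem5p3 (R : realType) (G : groupoidType)
    (finite_units : finite_set (@gpd_units G)) :
  closure (@Cc_to_Cstar R G @` range (@full_group_rep R G)) =
    [set: full_Cstar R G] <->
  is_group G.
Proof.
split=> [clT|grpG]; last first.
  rewrite group_full_group_rep_surj// -subTset => p _ B.
  move=> /nbhs_normP[_ /gt0_complex[r r0 ->] rB].
  have [f pf] := to_completion_approx p r0.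
  by exists (Cc_to_Cstar f); split; [exists f|exact: rB].
have [a0] := @gpd_nonempty G; pose d := gpd_rng a0.
have ud : gpd_units d by exists a0.
exists d; apply/seteqP; split=> [e ue|_ ->//].
apply: contrapT => /= /nesym de.
have [r r0 rP] := full_group_rep_away R finite_units ud ue de.
have : closure (@Cc_to_Cstar R G @` range (@full_group_rep R G))
    (Cc_to_Cstar (point_mass R d)) by rewrite clT.
have rC0 : 0 < r%:C :> R[i] by rewrite ltcR.
move=> /(_ _ (nbhsx_ballx _ _ rC0))[_ [[_ [x _ <-] <-]]].
by rewrite -ball_normE /= norm_Cc_to_Cstar_sub ltcR ltNge rP.
Qed.
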